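(* Let $\alpha : I \to \mathbb{R}^3$ be a curve with curvature greater than zero. Then $\alpha$ is a geodesic curve on some general cone with vertex at the origin if and only if $\alpha$ is a rectifying curve.
   Context: $I\subseteq\mathbb{R}$ is an open interval; curves are smooth and regular. The notions below are stated for curves parametrized by arc length; a regular curve is said to have one of these properties if its arc length reparametrization does. Frenet frame: for a unit speed curve $\alpha$ with positive curvature $\kappa$, put $\mathbf{t}=\alpha'$, $\mathbf{n}=\alpha''/\kappa$, $\mathbf{b}=\mathbf{t}\times\mathbf{n}$. Rectifying curve: a unit speed curve $\alpha$ with positive curvature whose position vector always lies in its rectifying plane, i.e. $\alpha(s)\in\operatorname{span}\{\mathbf{t}(s),\mathbf{b}(s)\}$ for all $s$. General cone with vertex at the origin: given a regular curve $\mathbf{y}=\mathbf{y}(t)$ defined on an open interval and lying on the unit sphere centered at $0\in\mathbb{R}^3$, the cone $C_{\mathbf{y}}$ over $\mathbf{y}$ is the parametrized surface $C_{\mathbf{y}}(t,u)=u\,\mathbf{y}(t)$, $u\in\mathbb{R}^+=(0,\infty)$, with unit normal $\mathbf{N}(t,u)$ parallel to $\mathbf{y}(t)\times\mathbf{y}'(t)$. Curve on the cone: a curve of the form $\alpha(s)=u(s)\,\mathbf{y}(t(s))$ with $u>0$ and $t$ smooth functions of $s$. A unit speed curve on the cone is a geodesic if $\alpha''(s)$ is parallel to $\mathbf{N}(t(s),u(s))$ for all $s$ (zero is allowed). *)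

(* Defs.v *)
From Stdlib Require Import Reals.
From Coquelicot Require Import Coquelicot.
Open Scope R_scope.

(* The vector space operations are Coquelicot's [plus] and [scal] on the
   product.  Its [norm] is not used: [vnorm] is the Euclidean norm written
   with the dot product. *)
Definition R3 : Type := (R * R * R)%type.

Definition crd1 (v : R3) : R := fst (fst v).
Definition crd2 (v : R3) : R := snd (fst v).
Definition crd3 (v : R3) : R := snd v.

Definition dot (v w : R3) : R :=
  crd1 v * crd1 w + crd2 v * crd2 w + crd3 v * crd3 w.

Definition vnorm (v : R3) : R := sqrt (dot v v).

Definition cross (v w : R3) : R3 :=
  (crd2 v * crd3 w - crd3 v * crd2 w,
   crd3 v * crd1 w - crd1 v * crd3 w,
   crd1 v * crd2 w - crd2 v * crd1 w).

Definition parallel (v w : R3) : Prop := exists c : R, v = scal c w.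

Definition in_span2 (v w1 w2 : R3) : Prop :=
  exists a b : R, v = plus (scal a w1) (scal b w2).

(* Possibly unbounded. *)
Definition is_open_interval (I : R -> Prop) : Prop :=
  (exists x, I x) /\ open I /\
  (forall x y z, I x -> I z -> x <= y <= z -> I y).

(* A curve on I is a total function R -> R3 of which only the values on I
   matter: I is open, so the derivatives at points of I depend on nothing
   else. *)
Definition deriv (c : R -> R3) (t : R) : R3 :=
  (Derive (fun x => crd1 (c x)) t,
   Derive (fun x => crd2 (c x)) t,
   Derive (fun x => crd3 (c x)) t).

Definition smooth_fun (I : R -> Prop) (f : R -> R) : Prop :=
  forall (n : nat) (t : R), I t -> ex_derive_n f n t.

Definition smooth_curve (I : R -> Prop) (c : R -> R3) : Prop :=
  smooth_fun I (fun x => crd1 (c x)) /\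
  smooth_fun I (fun x => crd2 (c x)) /\
  smooth_fun I (fun x => crd3 (c x)).

Definition regular_curve (I : R -> Prop) (c : R -> R3) : Prop :=
  smooth_curve I c /\ forall t, I t -> deriv c t <> zero.

Definition unit_speed_curve (I : R -> Prop) (c : R -> R3) : Prop :=
  smooth_curve I c /\ forall t, I t -> vnorm (deriv c t) = 1.

Definition arc_length (c : R -> R3) (t0 t : R) : R :=
  RInt (fun x => vnorm (deriv c x)) t0 t.

(* beta, on the interval J of arc length values, is the reparametrization of
   alpha by arc length measured from some base point of I. *)
Definition arc_length_reparam (I : R -> Prop) (alpha : R -> R3)
    (J : R -> Prop) (beta : R -> R3) : Prop :=
  exists t0, I t0 /\
    (forall s, J s <-> exists t, I t /\ s = arc_length alpha t0 t) /\
    (forall t, I t -> beta (arc_length alpha t0 t) = alpha t).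

(* Extends a property of unit speed curves to regular curves.  The choice of
   base point only translates the parameter of beta. *)
Definition by_arc_length (P : (R -> Prop) -> (R -> R3) -> Prop)
    (I : R -> Prop) (alpha : R -> R3) : Prop :=
  exists (J : R -> Prop) (beta : R -> R3),
    arc_length_reparam I alpha J beta /\ P J beta.

(* Curvature and Frenet frame of a unit speed curve. *)
Definition curvature (c : R -> R3) (s : R) : R := vnorm (deriv (deriv c) s).

Definition tangent (c : R -> R3) (s : R) : R3 := deriv c s.

Definition normal (c : R -> R3) (s : R) : R3 :=
  scal (/ curvature c s) (deriv (deriv c) s).

Definition binormal (c : R -> R3) (s : R) : R3 :=
  cross (tangent c s) (normal c s).

Definition positive_curvature_us (I : R -> Prop) (c : R -> R3) : Prop :=
  forall s, I s -> 0 < curvature c s.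

Definition rectifying_us (I : R -> Prop) (c : R -> R3) : Prop :=
  unit_speed_curve I c /\ positive_curvature_us I c /\
  forall s, I s -> in_span2 (c s) (tangent c s) (binormal c s).

Definition positive_curvature := by_arc_length positive_curvature_us.

Definition rectifying := by_arc_length rectifying_us.

Definition spherical_curve (K : R -> Prop) (y : R -> R3) : Prop :=
  is_open_interval K /\ regular_curve K y /\ forall t, K t -> vnorm (y t) = 1.

Definition cone (y : R -> R3) (t u : R) : R3 := scal u (y t).

(* The vector product of the partial derivatives of [cone y] in u and t is
   u (y t x y' t), so for u > 0 the unit normal does not depend on u. *)
Definition cone_normal (y : R -> R3) (t u : R) : R3 :=
  let w := cross (y t) (deriv y t) in scal (/ vnorm w) w.

Definition geodesic_on_cone_us (K : R -> Prop) (y : R -> R3)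
    (I : R -> Prop) (c : R -> R3) : Prop :=
  unit_speed_curve I c /\
  exists t u : R -> R,
    smooth_fun I t /\ smooth_fun I u /\
    (forall s, I s -> K (t s) /\ 0 < u s /\ c s = cone y (t s) (u s)) /\
    (forall s, I s -> parallel (deriv (deriv c) s) (cone_normal y (t s) (u s))).

Definition geodesic_on_cone (K : R -> Prop) (y : R -> R3) :=
  by_arc_length (geodesic_on_cone_us K y).

Definition geodesic_on_some_cone (I : R -> Prop) (alpha : R -> R3) : Prop :=
  exists (K : R -> Prop) (y : R -> R3),
    spherical_curve K y /\ geodesic_on_cone K y I alpha.

(* Main.v *)
Require Import Defs.
From Stdlib Require Import Reals Ranalysis5 Lra.
From Coquelicot Require Import Coquelicot.
Open Scope R_scope.

(* The normal of a cone is orthogonal to its rulings, so a unit speed geodesic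
   c = u y on a cone satisfies c . c'' = 0; this says that c has no component
   along the principal normal, i.e. that c is rectifying.

   Conversely let c . c'' = 0.  Then (c . c')' = 1, and
   d = |c|^2 - (c . c')^2 is constant.  If d = 0, then c = (c . c') c' and the
   curvature vanishes wherever c . c' does not; so d > 0.  Hence c never
   meets the origin, and its radial projection y = c / |c| is regular because
   y x y' = (c x c') / |c|^2 and |c x c'|^2 = d.  On the cone over y the curve c
   is a geodesic: c'' is orthogonal to c and to c', hence parallel to
   y x y'. *)

(** * Smooth functions *)

(* The derivatives are constrained on [J] only, so the rules for sums and
   products hold for them without any extensionality argument. *)
Fixpoint n_times_diff (n : nat) (J : R -> Prop) (f : R -> R) : Prop :=
  match n with
  | O => True
  | S m => exists f' : R -> R,
      (forall t, J t -> is_derive f t (f' t)) /\ n_times_diff m J f'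
  end.

Lemma smooth_fun_derivable J f t :
  smooth_fun J f -> J t -> is_derive f t (Derive f t).
Proof. intros Hf Jt. apply Derive_correct, (Hf 1%nat t Jt). Qed.

Lemma smooth_fun_Derive J f : smooth_fun J f -> smooth_fun J (Derive f).
Proof.
  intros Hf [|n] t Jt; [exact I|].
  apply ex_derive_ext with (Derive_n f (S n)).
  - intros x. rewrite <- (Nat.add_1_r n). symmetry. exact (Derive_n_comp f n 1 x).
  - exact (Hf (S (S n)) t Jt).
Qed.

Lemma smooth_fun_n_times_diff J f n : smooth_fun J f -> n_times_diff n J f.
Proof.
  revert f. induction n as [|n IH]; intros f Hf; [exact I|].
  exists (Derive f). split.
  - intros t. now apply smooth_fun_derivable.
  - apply IH. now apply smooth_fun_Derive.
Qed.

(** Openness of [J] makes the witness [f'] agree with [Derive f] near each point, so the induction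
    can pass to [Derive f]. *)
Lemma n_times_diff_ex_derive_n J f n t :
  open J -> n_times_diff n J f -> J t -> ex_derive_n f n t.
Proof.
  intros oJ. revert f t. induction n as [|n IH]; intros f t Hf Jt; [exact I|].
  destruct Hf as (f' & Hf' & Hn).
  assert (HD : ex_derive_n (Derive f) n t).
  { apply ex_derive_n_ext_loc with f'; [|now apply IH].
    apply (locally_open J); trivial.
    intros x Jx. symmetry. now apply is_derive_unique, Hf'. }
  (* Order one asks that [f] itself be differentiable, on which [HD] is silent; from order two on,
     [HD] shifts by one derivative. *)
  destruct n as [|n].
  - exists (f' t). now apply Hf'.
  - apply ex_derive_ext with (Derive_n (Derive f) n); [|exact HD].
    intros x. rewrite <- (Nat.add_1_r n). exact (Derive_n_comp f n 1 x).
Qed.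

Lemma n_times_diff_smooth_fun J f :
  open J -> (forall n, n_times_diff n J f) -> smooth_fun J f.
Proof. intros oJ Hf n t Jt. now apply n_times_diff_ex_derive_n with J. Qed.

Lemma n_times_diff_pred J f n : n_times_diff (S n) J f -> n_times_diff n J f.
Proof.
  revert f. induction n as [|n IH]; intros f Hf; [exact I|].
  destruct Hf as (f' & Hf' & Hn). exists f'. split; trivial. now apply IH.
Qed.

Lemma is_derive_Rplus f g x f' g' :
  is_derive f x f' -> is_derive g x g' ->
  is_derive (fun t => f t + g t) x (f' + g').
Proof. exact (@is_derive_plus R_AbsRing R_NormedModule f g x f' g'). Qed.

Lemma n_times_diff_plus J f g n :
  n_times_diff n J f -> n_times_diff n J g ->
  n_times_diff n J (fun x => f x + g x).
Proof.
  revert f g. induction n as [|n IH]; intros f g Hf Hg; [exact I|].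
  destruct Hf as (f' & Hf' & Hfn), Hg as (g' & Hg' & Hgn).
  exists (fun x => f' x + g' x). split; [|now apply IH].
  intros t Jt. apply is_derive_Rplus; auto.
Qed.

Lemma is_derive_Rmult f g x f' g' :
  is_derive f x f' -> is_derive g x g' ->
  is_derive (fun t => f t * g t) x (f' * g x + f x * g').
Proof.
  intros Hf Hg.
  apply (@is_derive_mult R_AbsRing f g x f' g' Hf Hg Rmult_comm).
Qed.

Lemma n_times_diff_mult J f g n :
  n_times_diff n J f -> n_times_diff n J g ->
  n_times_diff n J (fun x => f x * g x).
Proof.
  revert f g. induction n as [|n IH]; intros f g Hf Hg; [exact I|].
  pose proof (n_times_diff_pred _ _ _ Hf) as Pf.
  pose proof (n_times_diff_pred _ _ _ Hg) as Pg.
  destruct Hf as (f' & Hf' & Hfn), Hg as (g' & Hg' & Hgn).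
  exists (fun x => f' x * g x + f x * g' x). split.
  - intros t Jt. apply is_derive_Rmult; auto.
  - apply n_times_diff_plus; now apply IH.
Qed.

Lemma n_times_diff_const J c n : n_times_diff n J (fun _ => c).
Proof.
  revert c. induction n as [|n IH]; intros c; [exact I|].
  exists (fun _ => 0). split; [|apply IH].
  intros t _. apply (@is_derive_const R_AbsRing R_NormedModule).
Qed.

Lemma n_times_diff_id J n : n_times_diff n J (fun x => x).
Proof.
  destruct n as [|n]; [exact I|].
  exists (fun _ => 1). split; [|apply n_times_diff_const].
  intros t _. apply (@is_derive_id R_AbsRing).
Qed.

(* [w = / sqrt q] satisfies [w' = - q' w^3 / 2], so each order of
   differentiability of w yields the next one. *)
Lemma n_times_diff_inv_sqrt J q n :
  smooth_fun J q -> (forall t, J t -> 0 < q t) ->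
  n_times_diff n J (fun x => / sqrt (q x)).
Proof.
  intros Hq Pq. induction n as [|n IH]; [exact I|].
  exists (fun x => - (1 / 2) * (Derive q x *
    (/ sqrt (q x) * (/ sqrt (q x) * / sqrt (q x))))).
  split.
  - intros t Jt. pose proof (sqrt_lt_R0 _ (Pq t Jt)) as Hs.
    replace (- (1 / 2) * _)
      with (- (Derive q t / (2 * sqrt (q t))) / sqrt (q t) ^ 2)
      by (field; lra).
    apply (is_derive_inv (fun x => sqrt (q x))); [|lra].
    apply (is_derive_sqrt q); [now apply smooth_fun_derivable with J|now apply Pq].
  - apply n_times_diff_mult; [apply n_times_diff_const|].
    apply n_times_diff_mult;
      [now apply smooth_fun_n_times_diff, smooth_fun_Derive|].
    now repeat apply n_times_diff_mult.
Qed.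

(** The derivative [q' / (2 sqrt q)] is a product of factors already known to be differentiable to
    every order. *)
Lemma n_times_diff_sqrt J q n :
  smooth_fun J q -> (forall t, J t -> 0 < q t) ->
  n_times_diff n J (fun x => sqrt (q x)).
Proof.
  intros Hq Pq. destruct n as [|n]; [exact I|].
  exists (fun x => 1 / 2 * (Derive q x * / sqrt (q x))). split.
  - intros t Jt. pose proof (sqrt_lt_R0 _ (Pq t Jt)) as Hs.
    replace (1 / 2 * _) with (Derive q t / (2 * sqrt (q t))) by (field; lra).
    apply (is_derive_sqrt q); [now apply smooth_fun_derivable with J|now apply Pq].
  - apply n_times_diff_mult; [apply n_times_diff_const|].
    apply n_times_diff_mult;
      [now apply smooth_fun_n_times_diff, smooth_fun_Derive|].
    now apply n_times_diff_inv_sqrt.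
Qed.

(** * Vectors and curves *)

Lemma R3_ext (v w : R3) :
  crd1 v = crd1 w -> crd2 v = crd2 w -> crd3 v = crd3 w -> v = w.
Proof.
  destruct v as [[v1 v2] v3], w as [[w1 w2] w3]. cbn. now intros -> -> ->.
Qed.

(** Operations on the nested product unfold layer by layer, down to those of the reals; hence the
    repeated rounds. *)
Ltac coordinates :=
  unfold dot, cross, scal, plus, zero, crd1, crd2, crd3 in *; cbn in *;
  unfold scal, plus, mult, zero in *; cbn in *;
  unfold mult in *; cbn in *.

Lemma dot_nonneg v : 0 <= dot v v.
Proof. unfold dot. nra. Qed.

Lemma dot_eq_0 v : dot v v = 0 -> v = zero.
Proof.
  intros H. unfold dot in H.
  apply R3_ext; cbn; unfold zero; cbn; nra.
Qed.

Lemma dot_pos v : v <> zero -> 0 < dot v v.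
Proof.
  intros Hv. destruct (dot_nonneg v) as [H|H]; trivial.
  symmetry in H. now apply dot_eq_0 in H.
Qed.

Lemma dot_comm v w : dot v w = dot w v.
Proof. unfold dot. ring. Qed.

Lemma dot_scal_l a v w : dot (scal a v) w = a * dot v w.
Proof. coordinates. ring. Qed.

Lemma dot_plus_l u v w : dot (plus u v) w = dot u w + dot v w.
Proof. coordinates. ring. Qed.

Lemma dot_zero_r v : dot v zero = 0.
Proof. coordinates. ring. Qed.

Lemma vnorm_sqr v : vnorm v * vnorm v = dot v v.
Proof. apply sqrt_sqrt, dot_nonneg. Qed.

Lemma vnorm_pos v : v <> zero -> 0 < vnorm v.
Proof. intros Hv. now apply sqrt_lt_R0, dot_pos. Qed.

Lemma cross_orthogonal_l v w : dot v (cross v w) = 0.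
Proof. coordinates. ring. Qed.

Lemma dot_cross_cross v w :
  dot (cross v w) (cross v w) = dot v v * dot w w - dot v w * dot v w.
Proof. coordinates. ring. Qed.

(** With [w = a x b], the vector [v x w = (v . b) a - (v . a) b] vanishes, and
    [(w . w) v = (v . w) w + w x (v x w)]. The form without division also covers dependent [a],
    [b]. *)
Lemma orthogonal_to_both v a b :
  dot v a = 0 -> dot v b = 0 ->
  scal (dot (cross a b) (cross a b)) v = scal (dot v (cross a b)) (cross a b).
Proof.
  intros Ha Hb.
  assert (H : cross v (cross a b) = zero).
  { transitivity (plus (scal (dot v b) a) (scal (- dot v a) b)).
    - apply R3_ext; coordinates; ring.
    - rewrite Ha, Hb. apply R3_ext; coordinates; ring. }
  transitivity (plus (scal (dot v (cross a b)) (cross a b))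
                     (cross (cross a b) (cross v (cross a b)))).
  - set (w := cross a b). apply R3_ext; coordinates; ring.
  - rewrite H. set (w := cross a b). apply R3_ext; coordinates; ring.
Qed.

(** [deriv] is total, so an equation [deriv c s = v] does not assert differentiability; this
    relation does. *)
Definition is_derive3 (c : R -> R3) (s : R) (v : R3) : Prop :=
  is_derive (fun x => crd1 (c x)) s (crd1 v) /\
  is_derive (fun x => crd2 (c x)) s (crd2 v) /\
  is_derive (fun x => crd3 (c x)) s (crd3 v).

Lemma is_derive3_unique c s v : is_derive3 c s v -> deriv c s = v.
Proof.
  intros (H1 & H2 & H3). apply R3_ext; cbn; now apply is_derive_unique.
Qed.

Lemma smooth_curve_derivable J c s :
  smooth_curve J c -> J s -> is_derive3 c s (deriv c s).
Proof.
  intros (H1 & H2 & H3) Js.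
  split; [|split]; now apply smooth_fun_derivable with J.
Qed.

Lemma smooth_curve_deriv J c : smooth_curve J c -> smooth_curve J (deriv c).
Proof.
  intros (H1 & H2 & H3). split; [|split]; now apply smooth_fun_Derive.
Qed.

Lemma is_derive_dot a b s va vb :
  is_derive3 a s va -> is_derive3 b s vb ->
  is_derive (fun x => dot (a x) (b x)) s (dot va (b s) + dot (a s) vb).
Proof.
  intros (A1 & A2 & A3) (B1 & B2 & B3). unfold dot.
  match goal with |- is_derive _ _ ?l =>
    replace l with
     (crd1 va * crd1 (b s) + crd1 (a s) * crd1 vb +
      (crd2 va * crd2 (b s) + crd2 (a s) * crd2 vb) +
      (crd3 va * crd3 (b s) + crd3 (a s) * crd3 vb)) by ring end.
  apply is_derive_Rplus; [apply is_derive_Rplus|]; now apply is_derive_Rmult.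
Qed.

Lemma is_derive3_scal (f : R -> R) (c : R -> R3) (s f' : R) (v : R3) :
  is_derive f s f' -> is_derive3 c s v ->
  is_derive3 (fun x => scal (f x) (c x)) s
    (plus (scal f' (c s)) (scal (f s) v)).
Proof.
  intros Hf (H1 & H2 & H3).
  split; [|split]; now apply is_derive_Rmult.
Qed.

Lemma smooth_dot J a b :
  open J -> smooth_curve J a -> smooth_curve J b ->
  smooth_fun J (fun x => dot (a x) (b x)).
Proof.
  intros oJ (A1 & A2 & A3) (B1 & B2 & B3).
  apply n_times_diff_smooth_fun; trivial. intros n. unfold dot.
  apply n_times_diff_plus; [apply n_times_diff_plus|];
    apply n_times_diff_mult; now apply smooth_fun_n_times_diff.
Qed.

(** Serves to differentiate an identity that holds throughout [J]. *)
Lemma locally_constant_deriv J (f : R -> R) (s l k : R) :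
  open J -> (forall x, J x -> f x = k) -> J s -> is_derive f s l -> l = 0.
Proof.
  intros oJ Hf Js Hl.
  rewrite <- (is_derive_unique _ _ _ Hl).
  apply is_derive_unique, is_derive_ext_loc with (fun _ => k).
  - apply (locally_open J); trivial. intros x Jx. symmetry. now apply Hf.
  - apply (@is_derive_const R_AbsRing R_NormedModule).
Qed.

(** * Intervals and arc length *)

Lemma derivative_zero_constant J (f : R -> R) :
  is_open_interval J -> (forall s, J s -> is_derive f s 0) ->
  forall x y, J x -> J y -> f x = f y.
Proof.
  intros (_ & _ & cJ) Hf.
  assert (H : forall x y, J x -> J y -> x < y -> f x = f y).
  { intros x y Jx Jy. apply eq_is_derive. intros t Ht.
    now apply Hf, cJ with x y. }
  intros x y Jx Jy.
  destruct (Rtotal_order x y) as [L|[->|L]]; auto. symmetry. auto.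
Qed.

Section IncreasingImage.
Variables (I : R -> Prop) (f g : R -> R).
Hypothesis I_interval : is_open_interval I.
Hypothesis f_deriv : forall t, I t -> is_derive f t (g t).
Hypothesis g_pos : forall t, I t -> 0 < g t.

Lemma derivable_continuity_pt t : I t -> continuity_pt f t.
Proof.
  intros It. apply continuity_pt_filterlim.
  apply (@ex_derive_continuous R_AbsRing R_NormedModule f t).
  exists (g t). now apply f_deriv.
Qed.

Lemma positive_derivative_lt x y : I x -> I y -> x < y -> f x < f y.
Proof.
  intros Ix Iy Lxy. destruct I_interval as (_ & _ & cI).
  assert (HI : forall t, Rmin x y <= t <= Rmax x y -> I t).
  { intros t. rewrite Rmin_left, Rmax_right by lra. now apply cI. }
  destruct (MVT_gen f x y g) as (c & Hc & E).
  - intros t Ht. apply f_deriv, HI. lra.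
  - intros t Ht. now apply derivable_continuity_pt, HI.
  - pose proof (g_pos c (HI c Hc)). nra.
Qed.

Lemma intermediate_value x y s :
  I x -> I y -> f x <= s <= f y -> exists t, I t /\ s = f t.
Proof.
  (* When [s] is an end value, [x] or [y] itself is the preimage. Strict inequalities remain, and
     monotonicity then forces [x < y]. *)
  intros Ix Iy [[Hx|Hx] [Hy|Hy]]; [|exists y|exists x|exists x]; auto.
  assert (Lxy : x < y).
  { destruct (Rtotal_order x y) as [L|[->|L]]; [trivial|lra|].
    pose proof (positive_derivative_lt y x Iy Ix L). lra. }
  destruct I_interval as (_ & _ & cI).
  destruct (IVT_interv (fun t => f t - s) x y) as (t & Ht & E); try lra.
  - intros t Ht. apply continuity_pt_minus.
    + apply derivable_continuity_pt, cI with x y; auto.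
    + apply continuity_pt_const. now intros ? ?.
  - exists t. split; [now apply cI with x y|lra].
Qed.

(** The values at two points of [I] on either side of [t] enclose a neighbourhood of [f t] inside
    the image; convexity is the intermediate value property. *)
Lemma increasing_image_open_interval J :
  (forall s, J s <-> exists t, I t /\ s = f t) -> is_open_interval J.
Proof.
  intros HJ. pose proof I_interval as ((t0 & It0) & oI & _).
  repeat split.
  - exists (f t0). apply HJ. eauto.
  - intros s Js. apply HJ in Js as (t & It & ->).
    destruct (oI t It) as (e & He). pose proof (cond_pos e) as Pe.
    assert (Ia : I (t - e / 2)).
    { apply He. apply Rabs_def1; cbn; lra. }
    assert (Ib : I (t + e / 2)).
    { apply He. apply Rabs_def1; cbn; lra. }
    assert (La : f (t - e / 2) < f t) by (apply positive_derivative_lt; auto; lra).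
    assert (Lb : f t < f (t + e / 2)) by (apply positive_derivative_lt; auto; lra).
    apply (locally_interval J (f t) (f (t - e / 2)) (f (t + e / 2))); trivial.
    intros s H1 H2. apply HJ.
    apply intermediate_value with (t - e / 2) (t + e / 2); auto.
    cbn in H1, H2. lra.
  - intros x y z Jx Jz Hy. apply HJ in Jx as (a & Ia & ->).
    apply HJ in Jz as (b & Ib & ->). apply HJ.
    now apply intermediate_value with a b.
Qed.
End IncreasingImage.

(** * Reparametrization by arc length *)

Section ArcLength.
Variables (I : R -> Prop) (alpha : R -> R3).
Hypothesis I_interval : is_open_interval I.
Hypothesis alpha_regular : regular_curve I alpha.

Lemma speed_continuous t :
  I t -> continuous (fun x => vnorm (deriv alpha x)) t.
Proof.
  intros It. destruct alpha_regular as (Sa & _).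
  apply (continuous_comp (fun x => dot (deriv alpha x) (deriv alpha x)) sqrt);
    [|apply continuous_sqrt].
  apply (@ex_derive_continuous R_AbsRing R_NormedModule).
  eexists. apply is_derive_dot;
    apply smooth_curve_derivable with I; trivial; now apply smooth_curve_deriv.
Qed.

Lemma speed_integrable a b :
  I a -> I b -> ex_RInt (fun x => vnorm (deriv alpha x)) a b.
Proof.
  intros Ia Ib. destruct I_interval as (_ & _ & cI).
  apply (@ex_RInt_continuous R_CompleteNormedModule).
  intros z Hz. apply speed_continuous.
  destruct (Rle_dec a b).
  - rewrite Rmin_left, Rmax_right in Hz by lra. now apply cI with a b.
  - rewrite Rmin_right, Rmax_left in Hz by lra. now apply cI with b a.
Qed.

Lemma is_derive_arc_length t0 t :
  I t0 -> I t ->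
  is_derive (arc_length alpha t0) t (vnorm (deriv alpha t)).
Proof.
  intros It0 It.
  apply (@is_derive_RInt R_NormedModule (fun x => vnorm (deriv alpha x))
           (arc_length alpha t0) t0 t); [|now apply speed_continuous].
  destruct I_interval as (_ & oI & _).
  apply (locally_open I); trivial. intros x Ix.
  now apply (@RInt_correct R_CompleteNormedModule), speed_integrable.
Qed.

Lemma arc_length_Chasles t0 t1 t :
  I t0 -> I t1 -> I t ->
  arc_length alpha t1 t = arc_length alpha t0 t + arc_length alpha t1 t0.
Proof.
  intros It0 It1 It. rewrite Rplus_comm. symmetry.
  apply (@RInt_Chasles R_CompleteNormedModule); now apply speed_integrable.
Qed.

Lemma arc_length_reparam_interval J beta :
  arc_length_reparam I alpha J beta -> is_open_interval J.
Proof.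
  intros (t0 & It0 & HJ & _).
  apply (increasing_image_open_interval I (arc_length alpha t0)
           (fun t => vnorm (deriv alpha t))); trivial.
  - intros t. now apply is_derive_arc_length.
  - intros t It. now apply vnorm_pos, alpha_regular.
Qed.

(** Arc lengths measured from two base points differ by the signed arc length between these
    points. *)
Lemma arc_length_reparam_shift J beta J' beta' :
  arc_length_reparam I alpha J beta ->
  arc_length_reparam I alpha J' beta' ->
  exists d, forall s, J s -> J' (s + d) /\ beta s = beta' (s + d).
Proof.
  intros (t0 & It0 & HJ & Hb) (t1 & It1 & HJ' & Hb').
  exists (arc_length alpha t1 t0). intros s Js.
  apply HJ in Js as (t & It & ->).
  rewrite <- arc_length_Chasles by trivial.
  rewrite Hb, Hb' by trivial. split; trivial. apply HJ'. eauto.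
Qed.

Lemma curvature_shift J beta beta' d s :
  open J -> (forall x, J x -> beta x = beta' (x + d)) -> J s ->
  curvature beta s = curvature beta' (s + d).
Proof.
  intros oJ Hb Js. unfold curvature. f_equal.
  (* Taken at the coordinate functions, [p] gives the coordinates of the second derivative, which
     commutes with translation. *)
  assert (H : forall p : R3 -> R,
    Derive_n (fun x => p (beta x)) 2 s = Derive_n (fun x => p (beta' x)) 2 (s + d)).
  { intros p. rewrite <- Derive_n_comp_trans. apply Derive_n_ext_loc.
    apply (locally_open J); trivial. intros x Jx. now rewrite Hb. }
  apply R3_ext; [exact (H crd1)|exact (H crd2)|exact (H crd3)].
Qed.

(** [positive_curvature] speaks of some reparametrization only; this carries it over to the one that
    a geodesic hypothesis supplies. *)
Lemma positive_curvature_any_reparam J beta :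
  positive_curvature I alpha -> arc_length_reparam I alpha J beta ->
  positive_curvature_us J beta.
Proof.
  intros (J' & beta' & R' & P') Rb s Js.
  destruct (arc_length_reparam_interval J beta Rb) as (_ & oJ & _).
  destruct (arc_length_reparam_shift J beta J' beta' Rb R') as (d & Hd).
  rewrite (curvature_shift J beta beta' d s); trivial.
  - now apply P', Hd.
  - intros x Jx. now apply Hd.
Qed.
End ArcLength.

(** * Unit speed curves *)

Section UnitSpeed.
Variables (J : R -> Prop) (c : R -> R3).
Hypothesis J_interval : is_open_interval J.
Hypothesis c_unit : unit_speed_curve J c.
Hypothesis c_curved : positive_curvature_us J c.

Lemma unit_speed_dot s : J s -> dot (deriv c s) (deriv c s) = 1.
Proof.
  intros Js. rewrite <- vnorm_sqr. destruct c_unit as (_ & H).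
  rewrite H by trivial. ring.
Qed.

Lemma is_derive3_curve s : J s -> is_derive3 c s (deriv c s).
Proof.
  intros Js. apply smooth_curve_derivable with J; trivial. apply c_unit.
Qed.

Lemma is_derive3_velocity s : J s -> is_derive3 (deriv c) s (deriv (deriv c) s).
Proof.
  intros Js. apply smooth_curve_derivable with J; trivial.
  apply smooth_curve_deriv, c_unit.
Qed.

Lemma velocity_orthogonal_acceleration s :
  J s -> dot (deriv c s) (deriv (deriv c) s) = 0.
Proof.
  intros Js.
  enough (dot (deriv (deriv c) s) (deriv c s)
          + dot (deriv c s) (deriv (deriv c) s) = 0)
    by (rewrite (dot_comm (deriv (deriv c) s)) in *; lra).
  apply (locally_constant_deriv J (fun x => dot (deriv c x) (deriv c x)) s _ 1);
    trivial.
  - apply J_interval.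
  - apply unit_speed_dot.
  - apply is_derive_dot; now apply is_derive3_velocity.
Qed.

Lemma acceleration_pos s :
  J s -> 0 < dot (deriv (deriv c) s) (deriv (deriv c) s).
Proof.
  intros Js. rewrite <- vnorm_sqr. pose proof (c_curved s Js).
  now apply Rmult_lt_0_compat.
Qed.

(** The acceleration is a positive multiple of the principal normal, and the rectifying plane is the
    orthogonal complement of that normal. *)
Lemma in_rectifying_plane_iff s :
  J s ->
  in_span2 (c s) (tangent c s) (binormal c s) <->
  dot (c s) (deriv (deriv c) s) = 0.
Proof.
  intros Js. pose proof (unit_speed_dot s Js) as HTT.
  pose proof (velocity_orthogonal_acceleration s Js) as HTA.
  pose proof (c_curved s Js) as Hk.
  pose proof (vnorm_sqr (deriv (deriv c) s)) as HAA.
  unfold binormal, tangent, normal. unfold curvature in *.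
  set (T := deriv c s) in *. set (A := deriv (deriv c) s) in *.
  set (k := vnorm A) in *. set (x := c s).
  split.
  - intros (a & b & ->).
    rewrite dot_plus_l, dot_scal_l, HTA, dot_scal_l. coordinates. ring.
  (* The frame is orthonormal and the binormal is [T x A / k], so the coefficients are the inner
     products of [x] with tangent and binormal. *)
  - intros HxA. exists (dot x T), (dot x (cross T A) / k).
    (* Without its tangential component, [x] is orthogonal to both [T] and [A], hence a multiple of
       [T x A]. *)
    set (z := plus x (scal (- dot x T) T)).
    assert (HzT : dot z T = 0).
    { unfold z. rewrite dot_plus_l, dot_scal_l, HTT. ring. }
    assert (HzA : dot z A = 0).
    { unfold z. rewrite dot_plus_l, dot_scal_l, HTA, HxA. ring. }
    assert (Hzw : dot z (cross T A) = dot x (cross T A)).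
    { unfold z. rewrite dot_plus_l, dot_scal_l, cross_orthogonal_l. ring. }
    pose proof (orthogonal_to_both z T A HzT HzA) as E.
    rewrite dot_cross_cross, HTT, HTA, Hzw, <- HAA in E.
    (* The factor [1 * (k * k) - 0 * 0] is the square of [T x A], in the shape that it has in
       [E]. *)
    transitivity (plus (scal (dot x T) T)
      (scal (/ (k * k)) (scal (1 * (k * k) - 0 * 0) z))).
    + unfold z. generalize (dot x T). intros m.
      apply R3_ext; coordinates; field; lra.
    + rewrite E. generalize (dot x (cross T A)) (dot x T). intros m p.
      apply R3_ext; coordinates; field; lra.
Qed.

Hypothesis c_rectifying : forall s, J s -> dot (c s) (deriv (deriv c) s) = 0.

Lemma is_derive_position_dot_velocity s :
  J s -> is_derive (fun x => dot (c x) (deriv c x)) s 1.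
Proof.
  intros Js.
  replace 1 with (dot (deriv c s) (deriv c s) + dot (c s) (deriv (deriv c) s))
    by (rewrite unit_speed_dot, c_rectifying by trivial; ring).
  apply is_derive_dot; [now apply is_derive3_curve|now apply is_derive3_velocity].
Qed.

(* The squared length of the component of c normal to its tangent. *)
Let h (s : R) : R := dot (c s) (c s) - dot (c s) (deriv c s) * dot (c s) (deriv c s).

Lemma normal_component_constant s1 s2 : J s1 -> J s2 -> h s1 = h s2.
Proof.
  apply derivative_zero_constant; trivial.
  intros s Js. unfold h.
  replace 0 with (dot (deriv c s) (c s) + dot (c s) (deriv c s)
     - (1 * dot (c s) (deriv c s) + dot (c s) (deriv c s) * 1))
    by (rewrite (dot_comm (deriv c s)); ring).
  apply (@is_derive_minus R_AbsRing R_NormedModule).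
  - apply is_derive_dot; now apply is_derive3_curve.
  - apply is_derive_Rmult; now apply is_derive_position_dot_velocity.
Qed.

Lemma normal_component_sqr s :
  J s ->
  let v := plus (c s) (scal (- dot (c s) (deriv c s)) (deriv c s)) in
  dot v v = h s.
Proof.
  intros Js v. unfold v, h.
  rewrite dot_plus_l, dot_scal_l, !(dot_comm _ (plus _ _)), !dot_plus_l,
    !dot_scal_l, (unit_speed_dot s Js), (dot_comm (deriv c s)).
  ring.
Qed.

(* If the normal component vanishes, then [c = l c'] with [l = c . c'] and
   [l' = 1]; differentiating, [l c'' = 0], so [l] would vanish identically. *)
Lemma normal_component_pos s : J s -> 0 < h s.
Proof.
  intros Js0.
  assert (H0 : 0 <= h s) by (rewrite <- normal_component_sqr; trivial; apply dot_nonneg).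
  destruct H0 as [H0|H0]; trivial. exfalso.
  assert (oJ : open J) by apply J_interval.
  assert (E : forall x, J x ->
    plus (c x) (scal (- dot (c x) (deriv c x)) (deriv c x)) = zero).
  { intros x Jx. apply dot_eq_0. rewrite normal_component_sqr by trivial.
    rewrite H0. now apply normal_component_constant. }
  assert (L : forall x, J x -> dot (c x) (deriv c x) = 0).
  { intros x Jx.
    pose proof (acceleration_pos x Jx) as HA.
    pose proof (velocity_orthogonal_acceleration x Jx) as HTA.
    (* Freezing [w] as a constant vector before differentiating the products with it at [x] avoids a
       third derivative of [c]. *)
    set (w := deriv (deriv c) x) in *.
    assert (K : forall a v, is_derive3 a x v ->
      is_derive (fun y => dot (a y) w) x (dot v w)).
    { intros a v Ha.
      replace (dot v w) with (dot v w + dot (a x) zero) by (rewrite dot_zero_r; ring).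
      apply (is_derive_dot a (fun _ => w)); trivial.
      split; [|split]; apply (@is_derive_const R_AbsRing R_NormedModule). }
    enough (dot (deriv c x) w
      - (1 * dot (deriv c x) w + dot (c x) (deriv c x) * dot w w) = 0) by nra.
    apply (locally_constant_deriv J
      (fun y => dot (c y) w - dot (c y) (deriv c y) * dot (deriv c y) w) x _ 0);
      trivial.
    - intros y Jy.
      transitivity (dot (plus (c y) (scal (- dot (c y) (deriv c y)) (deriv c y))) w).
      + rewrite dot_plus_l, dot_scal_l. ring.
      + rewrite E, dot_comm by trivial. apply dot_zero_r.
    - apply (@is_derive_minus R_AbsRing R_NormedModule).
      + now apply K, is_derive3_curve.
      + apply is_derive_Rmult; [now apply is_derive_position_dot_velocity|].
        now apply K, is_derive3_velocity. }
  pose proof (locally_constant_deriv J _ s 1 0 oJ L Js0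
    (is_derive_position_dot_velocity s Js0)).
  lra.
Qed.

Lemma position_sqr_pos s : J s -> 0 < dot (c s) (c s).
Proof. intros Js. pose proof (normal_component_pos s Js). unfold h in *. nra. Qed.

(** * The radial projection and the cone over it *)

Definition radial_projection (s : R) : R3 := scal (/ vnorm (c s)) (c s).

Lemma position_norm_pos s : J s -> 0 < vnorm (c s).
Proof. intros Js. now apply sqrt_lt_R0, position_sqr_pos. Qed.

Lemma smooth_position_sqr : smooth_fun J (fun x => dot (c x) (c x)).
Proof. apply smooth_dot; [apply J_interval|apply c_unit|apply c_unit]. Qed.

Lemma smooth_position_norm : smooth_fun J (fun x => vnorm (c x)).
Proof.
  apply n_times_diff_smooth_fun; [apply J_interval|]. intros n.
  apply n_times_diff_sqrt; [apply smooth_position_sqr|apply position_sqr_pos].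
Qed.

Lemma smooth_radial_projection : smooth_curve J radial_projection.
Proof.
  destruct c_unit as ((S1 & S2 & S3) & _).
  split; [|split]; (apply n_times_diff_smooth_fun; [apply J_interval|]);
    intros n;
    (apply (n_times_diff_mult J (fun x => / vnorm (c x)));
     [apply n_times_diff_inv_sqrt;
       [apply smooth_position_sqr|apply position_sqr_pos]
     |now apply smooth_fun_n_times_diff]).
Qed.

(** The coefficient [m] may stay unspecified: its term is parallel to [c] and drops out of the
    vector product with the projection. *)
Lemma deriv_radial_projection s :
  J s -> exists m, deriv radial_projection s =
    plus (scal m (c s)) (scal (/ vnorm (c s)) (deriv c s)).
Proof.
  intros Js. eexists. apply is_derive3_unique.
  apply (is_derive3_scal (fun x => / vnorm (c x)) c).
  - apply (is_derive_inv (fun x => vnorm (c x))); [apply (smooth_fun_derivable J)|].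
    + apply smooth_position_norm.
    + exact Js.
    + pose proof (position_norm_pos s Js). lra.
  - now apply is_derive3_curve.
Qed.

Lemma radial_projection_cross s :
  J s -> cross (radial_projection s) (deriv radial_projection s) =
    scal (/ dot (c s) (c s)) (cross (c s) (deriv c s)).
Proof.
  intros Js. destruct (deriv_radial_projection s Js) as (m & ->).
  rewrite <- vnorm_sqr. pose proof (position_norm_pos s Js) as Hr.
  unfold radial_projection. set (r := vnorm (c s)) in *.
  apply R3_ext; coordinates; field; lra.
Qed.

(** At unit speed, Lagrange's identity turns this square into the positive constant [h]. *)
Lemma position_cross_velocity_sqr s :
  J s -> 0 < dot (cross (c s) (deriv c s)) (cross (c s) (deriv c s)).
Proof.
  intros Js. rewrite dot_cross_cross, unit_speed_dot by trivial.
  pose proof (normal_component_pos s Js). unfold h in *. lra.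
Qed.

Lemma radial_projection_cross_sqr s :
  J s -> 0 < dot (cross (radial_projection s) (deriv radial_projection s))
                 (cross (radial_projection s) (deriv radial_projection s)).
Proof.
  intros Js. rewrite radial_projection_cross by trivial.
  rewrite dot_scal_l, (dot_comm _ (scal _ _)), dot_scal_l.
  pose proof (position_cross_velocity_sqr s Js).
  pose proof (Rinv_0_lt_compat _ (position_sqr_pos s Js)).
  now repeat apply Rmult_lt_0_compat.
Qed.

Lemma radial_projection_spherical : spherical_curve J radial_projection.
Proof.
  repeat split; try apply J_interval; try apply smooth_radial_projection.
  (* A vanishing velocity would make the vector product of position and velocity vanish, against the
     positivity of its square. *)
  - intros t Jt E. pose proof (radial_projection_cross_sqr t Jt) as H.
    rewrite E, dot_cross_cross in H. revert H. coordinates. lra.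
  - intros t Jt. unfold vnorm, radial_projection.
    rewrite dot_scal_l, (dot_comm _ (scal _ _)), dot_scal_l, <- vnorm_sqr.
    pose proof (position_norm_pos t Jt).
    rewrite <- sqrt_1. f_equal. field. lra.
Qed.

Lemma rectifying_geodesic_on_cone :
  geodesic_on_cone_us J radial_projection J c.
Proof.
  (* The directrix is parametrized by the arc length of [c], so [t] is the identity and [u] is the
     distance to the vertex. *)
  split; trivial. exists (fun s => s), (fun s => vnorm (c s)).
  repeat split; trivial.
  - apply n_times_diff_smooth_fun; [apply J_interval|].
    intros n. apply n_times_diff_id.
  - apply smooth_position_norm.
  - now apply position_norm_pos.
  - unfold cone, radial_projection. pose proof (position_norm_pos s H).
    apply R3_ext; coordinates; field; lra.
  - intros s Js. unfold cone_normal.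
    pose proof (position_sqr_pos s Js) as Hq.
    pose proof (position_cross_velocity_sqr s Js) as Hw.
    pose proof (sqrt_lt_R0 _ (radial_projection_cross_sqr s Js)) as Hn.
    fold (vnorm (cross (radial_projection s) (deriv radial_projection s))) in Hn.
    set (n := vnorm _) in *.
    rewrite radial_projection_cross by trivial.
    pose proof (orthogonal_to_both (deriv (deriv c) s) (c s) (deriv c s)) as E.
    rewrite !(dot_comm (deriv (deriv c) s)) in E.
    specialize (E (c_rectifying s Js) (velocity_orthogonal_acceleration s Js)).
    set (w := cross (c s) (deriv c s)) in *.
    set (A := deriv (deriv c) s) in *.
    (* By [E], [A] is [(w . A) / (w . w)] times [w]; the last two factors undo the scaling of [w] by
       [1 / (c . c)] in [y x y'] and the normalization by [n]. *)
    exists (/ dot w w * dot w A * dot (c s) (c s) * n).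
    transitivity (scal (/ dot w w) (scal (dot w w) A)).
    + generalize dependent (dot w w). intros k Hk _.
      apply R3_ext; coordinates; field; lra.
    + rewrite E. generalize (dot w A). intros p.
      generalize dependent (dot w w). intros k Hk _.
      generalize dependent (dot (c s) (c s)). intros q Hq.
      apply R3_ext; coordinates; field; lra.
Qed.
End UnitSpeed.

(** * Geodesics on cones and the equivalence *)

Lemma geodesic_on_cone_orthogonal K y J c s :
  geodesic_on_cone_us K y J c -> J s -> dot (c s) (deriv (deriv c) s) = 0.
Proof.
  intros (_ & t & u & _ & _ & Hc & Hg) Js.
  destruct (Hc s Js) as (_ & _ & ->). destruct (Hg s Js) as (k & ->).
  unfold cone, cone_normal.
  rewrite dot_scal_l, dot_comm, !dot_scal_l, dot_comm, cross_orthogonal_l. ring.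
Qed.

Theorem theorem3p2 (I : R -> Prop) (alpha : R -> R3)
    (I_interval : is_open_interval I)
    (alpha_regular : regular_curve I alpha)
    (alpha_curved : positive_curvature I alpha) :
  geodesic_on_some_cone I alpha <-> rectifying I alpha.
Proof.
  split.
  - intros (K & y & _ & J & beta & Rb & G).
    assert (oJ : is_open_interval J)
      by now apply (arc_length_reparam_interval I alpha) with beta.
    assert (P : positive_curvature_us J beta)
      by now apply (positive_curvature_any_reparam I alpha).
    exists J, beta. split; trivial. split; [apply G|]. split; trivial.
    intros s Js. apply (in_rectifying_plane_iff J beta); trivial; [apply G|].
    now apply (geodesic_on_cone_orthogonal K y J).
  - intros (J & beta & Rb & U & P & Hspan).
    assert (oJ : is_open_interval J)
      by now apply (arc_length_reparam_interval I alpha) with beta.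
    assert (HO : forall s, J s -> dot (beta s) (deriv (deriv beta) s) = 0).
    { intros s Js. apply (in_rectifying_plane_iff J beta); auto. }
    (* The cone is built over the projection of the unit speed curve [beta], with [J] as parameter
       interval of the directrix. *)
    exists J, (radial_projection beta). split.
    + now apply radial_projection_spherical.
    + exists J, beta. split; trivial. now apply rectifying_geodesic_on_cone.
Qed.
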